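(* Let $(S,\Sigma,\lambda)$ and $(Y,\mu)$ be $\sigma$-finite measure spaces and suppose $B:Y\to\Sigma$ is a core map. Then there exist positive, admissible maps $R:L^1+L^\infty\to L^1_\lambda+L^\infty_\lambda$ and $Q:L^1_\lambda+L^\infty_\lambda\to L^1+L^\infty$, each of norm at most one, such that $K_BR=J_B$ on $L^1+L^\infty$ and $J_BQ=K_B$ on $L^1_\lambda+L^\infty_\lambda$.
   Context: $L^p_\lambda$ denotes the usual Lebesgue space of complex-valued functions for the measure $\lambda$; $L^p$ (no subscript) is the Lebesgue space for Lebesgue measure on $(0,\infty)$. Core map: a map $B:Y\to\Sigma$ such that (I) the range of $B$ is totally ordered by inclusion; (II) for each $E\in\Sigma$, $y\mapsto\lambda(E\cap B(y))$ is $\mu$-measurable; (III) $\bigcup_{y\in Y}B(y)=\bigcup_{y\in Y_0}B(y)$ for some countable $Y_0\subseteq Y$; (IV) $\lambda(B(y))<\infty$ for all $y\in Y$. Operators: $K_Bg(y)=\int_{B(y)}g\,d\lambda$ and $J_Bf(y)=\int_0^{\lambda(B(y))}f(t)\,dt$ for $y\in Y$; because $\lambda(B(y))<\infty$, these formulas make sense for $g\in L^1_\lambda+L^\infty_\lambda$ and $f\in L^1+L^\infty$. Admissible map: for $\sigma$-finite measures $\alpha,\beta$, a linear map $T:L^1_\alpha+L^\infty_\alpha\to L^1_\beta+L^\infty_\beta$ is admissible if its restrictions $L^1_\alpha\to L^1_\beta$ and $L^\infty_\alpha\to L^\infty_\beta$ are bounded; its norm is the larger of the norms of these two restrictions. It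 is positive if it maps non-negative functions to non-negative functions. *)

(* Defs.v *)
From HB Require Import structures.
From mathcomp Require Import all_boot all_order all_algebra.
From mathcomp Require Import generic_quotient ring_quotient.
From mathcomp Require Import all_classical all_reals all_analysis.
From mathcomp Require Import measurable_realfun ess_sup_inf.
From mathcomp Require Import complex.
Set Implicit Arguments.
Unset Strict Implicit.
Unset Printing Implicit Defensive.
Import Order.TTheory GRing.Theory Num.Theory.
Import numFieldNormedType.Exports.
Local Open Scope classical_set_scope.
Local Open Scope ring_scope.
Local Open Scope complex_scope.
Local Open Scope quotient_scope.

(* The library's Lebesgue spaces are real-valued; below, the norms and
   integrals of complex-valued functions are reduced to the library's Lnorm of
   the modulus and Rintegral of the real and imaginary parts. *)

Section complex_functions.
Context d (T : measurableType d) (R : realType).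
Variable mu : {measure set T -> \bar R}.
Implicit Types (f g : T -> R[i]) (p : \bar R) (D : set T).

Definition cmeasurable f : Prop :=
  measurable_fun setT (fun x => complex.Re (f x)) /\
  measurable_fun setT (fun x => complex.Im (f x)).

Definition cLnorm p f : \bar R := 'N[mu]_p[(fun x => (Normc.normc (f x))%:E)].

Definition cLfun p : set (T -> R[i]) :=
  [set f | cmeasurable f /\ (cLnorm p f < +oo)%E].

Definition cintegral D f : R[i] :=
  (\int[mu]_(x in D) complex.Re (f x))%R +i* (\int[mu]_(x in D) complex.Im (f x))%R.

Definition cL1Linfty : {pred T -> R[i]} :=
  mem [set f | exists g h, [/\ cLfun 1%E g, cLfun +oo%E h & f = g + h]].

Lemma cmeasurableM a f : cmeasurable f -> cmeasurable (a *: f).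
Proof.
case: a => a b [mr mi]; split.
  rewrite (_ : (fun _ => _) = (fun x => a * complex.Re (f x) - b * complex.Im (f x))).
    by apply: measurable_funB; apply: measurable_funM.
  by apply/funext => x; rewrite /GRing.scale/=; case: (f x).
rewrite (_ : (fun _ => _) = (fun x => a * complex.Im (f x) + b * complex.Re (f x))).
  by apply: measurable_funD; apply: measurable_funM.
by apply/funext => x; rewrite /GRing.scale/=; case: (f x).
Qed.

Lemma cmeasurableD f g : cmeasurable f -> cmeasurable g -> cmeasurable (f + g).
Proof.
move=> [fr fi] [gr gi]; split.
  rewrite (_ : (fun _ => _) = (fun x => complex.Re (f x) + complex.Re (g x))).
    exact: measurable_funD.
  by apply/funext => x; rewrite /GRing.add/=; case: (f x); case: (g x).
rewrite (_ : (fun _ => _) = (fun x => complex.Im (f x) + complex.Im (g x))).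
  exact: measurable_funD.
by apply/funext => x; rewrite /GRing.add/=; case: (f x); case: (g x).
Qed.

Lemma cmeasurable_normc f : cmeasurable f ->
  measurable_fun setT (fun x => Normc.normc (f x)).
Proof.
move=> [fr fi].
rewrite (_ : (fun _ => _) = (fun x =>
    Num.sqrt (complex.Re (f x) ^+ 2 + complex.Im (f x) ^+ 2))).
  apply: (@measurableT_comp _ _ _ _ _ _ (@Num.sqrt R)).
    by apply: continuous_measurable_fun => z; exact: sqrt_continuous.
  by apply: measurable_funD; apply: measurable_funX.
by apply/funext => x; case: (f x).
Qed.

Lemma le_Lnorm p (F G : T -> R) : (1 <= p)%E ->
  measurable_fun setT F -> measurable_fun setT G ->
  (forall x, 0 <= F x <= G x) ->
  ('N[mu]_p[EFin \o F] <= 'N[mu]_p[EFin \o G])%E.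
Proof.
move=> p1 mF mG FG.
have nFG x : `|F x| <= `|G x|.
  by have /andP[F0 le] := FG x; rewrite !ger0_norm// (le_trans F0).
rewrite unlock; case: p p1 => [r|_|//].
  rewrite lee_fin => r1; have r0 : 0 <= r by rewrite (le_trans _ r1).
  have m (H : T -> R) : measurable_fun setT H ->
      measurable_fun setT (fun x => `|(EFin \o H) x| `^ r)%E.
    move=> mH; apply: (@measurableT_comp _ _ _ _ _ _ (fun y => (y `^ r)%E)).
      exact: measurable_poweR.
    by apply: measurableT_comp => //; apply/measurable_EFinP.
  have i0 H : (\int[mu]_x `|(EFin \o H) x| `^ r)%E \in `[0%E, +oo%E].
    by rewrite in_itv/= leey andbT integral_ge0// => x _; exact: poweR_ge0.
  apply: gt0_ler_poweR; rewrite ?invr_ge0 ?i0//.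
  apply: ge0_le_integral => //.
  - by move=> x _; exact: poweR_ge0.
  - exact: m.
  - exact: m.
  by move=> x _; rewrite !abse_EFin !poweR_EFin lee_fin ge0_ler_powR ?nnegrE.
case: ifPn => // _; apply: le_ess_sup; apply: nearW => x /=.
by rewrite lee_fin.
Qed.

Lemma cLfun_closed p a f g : (1 <= p)%E ->
  cLfun p f -> cLfun p g -> cLfun p (a *: f + g).
Proof.
move=> p1 [mf nf] [mg ng].
have mafg : cmeasurable (a *: f + g).
  by apply: cmeasurableD => //; exact: cmeasurableM.
split=> //; set F := fun x => Normc.normc (f x); set G := fun x => Normc.normc (g x).
have FL : F \in Lfun mu p.
  by rewrite inE/=; apply/andP; split; apply/mem_set => //; exact: cmeasurable_normc.
have GL : G \in Lfun mu p.
  by rewrite inE/=; apply/andP; split; apply/mem_set => //; exact: cmeasurable_normc.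
have : Normc.normc a *: F + G \in Lfun mu p.
  have := @Lfun_submod_closed _ T R mu p p1.
  by move=> [_ /(_ (Normc.normc a) _ _ FL GL)].
rewrite inE/= => /andP[/set_mem mH /set_mem/= nH].
apply: le_lt_trans nH; apply: le_Lnorm => //.
  exact: cmeasurable_normc.
move=> x; apply/andP; split; first by case: (_ x) => u v /=; exact: sqrtr_ge0.
rewrite (le_trans (le_normcD _ _))// lerD2r.
by rewrite -[leRHS]/(Normc.normc a * Normc.normc (f x)) -Normc.normcM.
Qed.

End complex_functions.

Section L1Linfty.
Context d (T : measurableType d) (R : realType).
Variable mu : {measure set T -> \bar R}.

Lemma cLfun0 p : (0 < p)%E -> cLfun mu p (0 : T -> R[i]).
Proof.
move=> p0; split; first by split; exact: measurable_cst.
rewrite /cLnorm (_ : (fun _ => _) = cst 0%E) ?Lnorm0 ?gt_eqF//.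
by apply/funext => x; rewrite Normc.normc0.
Qed.

Lemma cL1Linfty_submod_closed : submod_closed (cL1Linfty mu).
Proof.
split=> [|a f g].
  rewrite inE/=; exists 0, 0; split; rewrite ?addr0//; exact: cLfun0.
rewrite !inE/= => -[f1 [f2 [f1L f2L ->]]] [g1 [g2 [g1L g2L ->]]].
exists (a *: f1 + g1), (a *: f2 + g2); split.
- exact: cLfun_closed.
- by apply: cLfun_closed; rewrite ?leey.
- by rewrite scalerDr addrACA.
Qed.

HB.instance Definition _ := GRing.isSubmodClosed.Build _ _ (cL1Linfty mu)
  cL1Linfty_submod_closed.

Definition L1LinftyFun := {f : T -> R[i] | f \in cL1Linfty mu}.

HB.instance Definition _ := Choice.on L1LinftyFun.
HB.instance Definition _ := SubChoice.on L1LinftyFun.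
HB.instance Definition _ := [SubChoice_isSubLmodule of L1LinftyFun by <:].

Lemma L1LinftyFunD (f g : L1LinftyFun) x :
  val (f + g) x = val f x + val g x.
Proof. by rewrite GRing.valD. Qed.

Lemma L1LinftyFunB (f g : L1LinftyFun) x :
  val (f - g) x = val f x - val g x.
Proof. by rewrite raddfB. Qed.

Lemma L1LinftyFunZ a (f : L1LinftyFun) x : val (a *: f) x = a * val f x.
Proof. by rewrite GRing.valZ. Qed.

Definition ae0 : {pred L1LinftyFun} :=
  mem [set f : L1LinftyFun | \forall x \ae mu, val f x = 0].

Lemma ae0_submod_closed : submod_closed ae0.
Proof.
split=> [|a f g]; first by rewrite inE; apply: nearW.
rewrite !inE => f0 g0; apply: filterS2 f0 g0 => x fx0 gx0.
by rewrite L1LinftyFunD L1LinftyFunZ fx0 gx0 mulr0 addr0.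
Qed.

HB.instance Definition _ := GRing.isSubmodClosed.Build _ _ ae0
  ae0_submod_closed.

Definition L1Linfty : Type := Quotient.quot ae0.

HB.instance Definition _ := Choice.on L1Linfty.
HB.instance Definition _ := EqQuotient.on L1Linfty.
HB.instance Definition _ := GRing.Zmodule.on L1Linfty.

Lemma L1Linfty_piP (f g : L1LinftyFun) :
  \pi_L1Linfty f = \pi_L1Linfty g <-> \forall x \ae mu, val f x = val g x.
Proof.
have -> : (\pi_L1Linfty f = \pi_L1Linfty g) = (f - g \in ae0).
  by apply/propext; rewrite (@Quotient.idealrBE _ ae0); split=> /eqP.
rewrite inE; split; apply: filterS => x.
  by move=> /eqP; rewrite L1LinftyFunB subr_eq0 => /eqP.
by move=> fg; rewrite L1LinftyFunB fg subrr.
Qed.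

Lemma L1Linfty_piD (f g : L1LinftyFun) :
  \pi_L1Linfty (f + g) = \pi_L1Linfty f + \pi_L1Linfty g.
Proof. exact: (@Quotient.pi_add _ ae0). Qed.

Definition L1Linfty_scale (a : R[i]) (q : L1Linfty) : L1Linfty :=
  \pi_L1Linfty (a *: repr q).

Lemma L1Linfty_piZ a (f : L1LinftyFun) :
  \pi_L1Linfty (a *: f) = L1Linfty_scale a (\pi_L1Linfty f).
Proof.
apply/L1Linfty_piP.
have /L1Linfty_piP : \pi_L1Linfty f = \pi_L1Linfty (repr (\pi_L1Linfty f)) by rewrite reprK.
by apply: filterS => x fx; rewrite -[LHS]/(a * val f x) fx.
Qed.

Let scaleqA a b q :
  L1Linfty_scale a (L1Linfty_scale b q) = L1Linfty_scale (a * b) q.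
Proof. by elim/quotW: q => q; rewrite -(L1Linfty_piZ b) -!L1Linfty_piZ scalerA. Qed.

Let scale1q : left_id 1 L1Linfty_scale.
Proof. by elim/quotW => q; rewrite -L1Linfty_piZ scale1r. Qed.

Let scaleqDr : right_distributive L1Linfty_scale +%R.
Proof.
move=> a; elim/quotW => q; elim/quotW => r.
by rewrite -L1Linfty_piD -!L1Linfty_piZ scalerDr L1Linfty_piD.
Qed.

Let scaleqDl q : {morph L1Linfty_scale^~ q : a b / a + b}.
Proof.
elim/quotW: q => q a b.
by rewrite -!L1Linfty_piZ scalerDl L1Linfty_piD.
Qed.

HB.instance Definition _ := GRing.Zmodule_isLmodule.Build R[i] L1Linfty
  scaleqA scale1q scaleqDr scaleqDl.

(* A class is used as a function through a chosen representative, as for the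
   library's {mfun_ mu, _ >-> _}. *)
Definition L1Linfty_to_fun (q : L1Linfty) : T -> R[i] := val (repr q).
Coercion L1Linfty_to_fun : L1Linfty >-> Funclass.

Lemma L1Linfty_pi_ae (f : L1LinftyFun) :
  \forall x \ae mu, (\pi_L1Linfty f : L1Linfty) x = val f x.
Proof. by apply/L1Linfty_piP; rewrite reprK. Qed.

Lemma L1Linfty_ae_eq (q r : L1Linfty) :
  q = r <-> \forall x \ae mu, q x = r x.
Proof. by rewrite -L1Linfty_piP !reprK. Qed.

Definition LpNorm (p : \bar R) (q : L1Linfty) : \bar R := cLnorm mu p q.

Definition ae_nonneg (q : L1Linfty) : Prop := \forall x \ae mu, 0 <= q x.

End L1Linfty.

Section admissible.
Context d d' (T : measurableType d) (T' : measurableType d') (R : realType).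
Variables (alpha : {measure set T -> \bar R}) (beta : {measure set T' -> \bar R}).
Variable A : {linear L1Linfty alpha -> L1Linfty beta}.
Local Open Scope ereal_scope.

(* An element of L^1 + L^oo lies in L^p exactly when its p-norm is finite. *)
Definition bounded_on_Lp (p : \bar R) : Prop :=
  exists M : R, forall f : L1Linfty alpha, LpNorm p f < +oo ->
    LpNorm p (A f) <= M%:E * LpNorm p f.

Definition norm_on_Lp (p : \bar R) : \bar R :=
  ereal_sup [set LpNorm p (A f) |
             f in [set f : L1Linfty alpha | LpNorm p f <= 1]].

Definition admissible : Prop := bounded_on_Lp 1 /\ bounded_on_Lp +oo.

Definition admissible_norm : \bar R :=
  Order.max (norm_on_Lp 1) (norm_on_Lp +oo).

Definition positive_map : Prop :=
  forall f : L1Linfty alpha, ae_nonneg f -> ae_nonneg (A f).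

End admissible.

(* L^p(0, oo) is realised over the whole line with a measure that ignores
   ]-oo, 0]: a.e. classes only see the values on ]0, +oo[. *)
Definition lebesgue_halfline (R : realType) :
    {measure set (measurableTypeR R) -> \bar R} :=
  mrestr (@lebesgue_measure R) (measurable_itv `]0, +oo[).

Section core_maps.
Context dS dY (S : measurableType dS) (Y : measurableType dY) (R : realType).
Variables (lambda : {measure set S -> \bar R}) (B : Y -> set S).
Local Open Scope ereal_scope.

(* The measure mu on Y matters only through its sigma-algebra of
   mu-measurable sets, which is the one carried by Y. *)
Record core_map : Prop := CoreMap {
  core_measurable : forall y, measurable (B y) ;
  core_total : forall y z, B y `<=` B z \/ B z `<=` B y ;
  core_measurable_fun : forall E, measurable E ->
    measurable_fun [set: Y] (fun y => lambda (E `&` B y)) ;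
  core_countable : exists2 Y0 : set Y, countable Y0 &
    \bigcup_y B y = \bigcup_(y in Y0) B y ;
  core_finite : forall y, lambda (B y) < +oo }.

Definition KB (g : L1Linfty lambda) (y : Y) : R[i] := cintegral lambda (B y) g.

Definition JB (f : L1Linfty (lebesgue_halfline R)) (y : Y) : R[i] :=
  cintegral (lebesgue_halfline R) `]0%R, fine (lambda (B y))[ f.

End core_maps.

(* Main.v *)
Require Import Defs.
From HB Require Import structures.
From mathcomp Require Import all_boot all_order all_algebra.
From mathcomp Require Import all_classical all_reals all_analysis.
From mathcomp Require Import measurable_realfun ess_sup_inf.
From mathcomp Require Import complex.
From mathcomp Require Import ring lra.
Set Implicit Arguments.
Unset Strict Implicit.
Unset Printing Implicit Defensive.
Import Order.TTheory GRing.Theory Num.Theory.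
Import numFieldNormedType.Exports.
Local Open Scope classical_set_scope.
Local Open Scope ring_scope.

(* The sets [B y] on one side and the intervals ]0, lambda (B y)[ on the other
   are two chains with the same measures.  Pick a sequence [u] of indices whose
   measures are dense among all of them, and send a point [s] to the infimum
   [phi s] of the measures of the sets [B (u n)] containing it.  Sublevel sets of
   [phi] are unions of members of the chain, so their measure depends only on the
   sequence of measures: both sides have the same image measure [nu] on the real
   line, and each [B y] is a sublevel set of [phi] up to a null set.
   Conditional expectation along one map [phi] (Radon-Nikodym, [nu] being
   sigma-finite) followed by composition with the other one is then a positive
   operator of norm at most one on L^1 and on L^oo which preserves the integrals
   over corresponding members of the chains; its two directions are [QB] and [RB].
   That complex conditional expectation contracts follows from |E f| <= E |f|,
   obtained by testing real parts in countably many rational directions. *)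

Lemma ae_eq_integrable d (T : measurableType d) (R : realType)
    (mu : {measure set T -> \bar R}) A (f g : T -> \bar R) :
  measurable A -> measurable_fun A g -> ae_eq mu A f g ->
  mu.-integrable A f -> mu.-integrable A g.
Proof.
move=> mA mg fg /integrableP[mf foo]; apply/integrableP; split => //.
rewrite (ae_eq_integral (abse \o f))//; try exact: measurableT_comp.
by apply: filterS fg => x fgx Ax; rewrite /= fgx.
Qed.

(** * Change of variables along a measurable map restricted to a set *)

Section fibered_integral.
Context dS dZ (S : measurableType dS) (Z : measurableType dZ) (R : realType).
Variables (tau : {measure set S -> \bar R}) (nu : {measure set Z -> \bar R}).
Variables (D : set S) (phi : S -> Z).
Hypotheses (mD : measurable D) (mphi : measurable_fun setT phi).
Hypothesis nuE : forall E, measurable E -> nu E = tau (D `&` phi @^-1` E).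
Local Open Scope ereal_scope.

Lemma measurable_fiber E : measurable E -> measurable (D `&` phi @^-1` E).
Proof.
by move=> mE; apply: measurableI => //; rewrite -[X in measurable X]setTI; exact: mphi.
Qed.

(** [nu] is the image under [phi] of [tau] restricted to [D]: this is the image-measure formula, the
    complement of [D] being a null set of the restriction. *)
Lemma ge0_integral_fiber E (h : Z -> \bar R) : measurable E ->
  measurable_fun E h -> (forall z, E z -> 0 <= h z) ->
  \int[nu]_(z in E) h z = \int[tau]_(x in D `&` phi @^-1` E) h (phi x).
Proof.
move=> mE mh h0.
have mpE : measurable (phi @^-1` E) by rewrite -[X in measurable X]setTI; exact: mphi.
have mhp : measurable_fun (phi @^-1` E) (h \o phi).
  apply: (measurable_comp mE) => //; first by move=> _ [x Ex <-].
  exact: measurable_funTS.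
rewrite (eq_measure_integral (pushforward (mrestr tau mD) phi)); last first.
  by move=> A mA _; rewrite nuE// /pushforward /= /mrestr setIC.
rewrite ge0_integral_pushforward//; last by move=> z /[!inE]; exact: h0.
rewrite (ge0_negligible_integral (N := ~` D))//=; last 3 first.
- exact: measurableC.
- by move=> x Ex; apply: h0.
- by rewrite /mrestr setICl measure0.
rewrite setDE setCK setIC.
apply: eq_measure_integral => A mA AD; by rewrite /= /mrestr setIidl// => x /AD[].
Qed.

Lemma integral_fiber E (h : Z -> \bar R) : measurable E -> measurable_fun E h ->
  \int[nu]_(z in E) h z = \int[tau]_(x in D `&` phi @^-1` E) h (phi x).
Proof.
move=> mE mh; rewrite integralE [RHS]integralE.
rewrite !ge0_integral_fiber//; [|exact: measurable_funeneg|exact: measurable_funepos].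
by rewrite (_ : (fun x => h (phi x)) = h \o phi)// (funepos_comp h phi) (funeneg_comp h phi).
Qed.

Lemma ae_fiber (P : Z -> Prop) : {ae nu, forall z, P z} ->
  {ae tau, forall x, D x -> P (phi x)}.
Proof.
move=> [N [mN N0 PN]]; exists (D `&` phi @^-1` N); split.
- exact: measurable_fiber.
- by rewrite -nuE.
- by move=> x /= /not_implyP[Dx nP]; split => //; exact: PN.
Qed.

Lemma integrable_fiber E (h : Z -> \bar R) : measurable E ->
  nu.-integrable E h -> tau.-integrable (D `&` phi @^-1` E) (fun x => h (phi x)).
Proof.
move=> mE /integrableP[mh ih]; apply/integrableP; split.
  apply: (measurable_comp mE) => //; first by move=> _ [x [_ Ex] <-].
  exact: measurable_funTS.
rewrite -(ge0_integral_fiber (h := fun z => `|h z|))//.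
exact: measurableT_comp.
Qed.

End fibered_integral.

(** * Real conditional expectation along a map *)

Section conditional_expectation.
Context dS dZ (S : measurableType dS) (Z : measurableType dZ) (R : realType).
Variables (tau : {measure set S -> \bar R}) (nu : {measure set Z -> \bar R}).
Variables (D : set S) (phi : S -> Z) (F : (set Z)^nat).

(** [h] is a density of the image under [phi] of the charge [f tau], tested only inside the sets
    [F n]: in general a function of L^1 + L^oo is integrable only over sets of finite measure. *)
Definition condexp (f : S -> R) (h : Z -> R) : Prop :=
  [/\ measurable_fun setT h,
      forall n, tau.-integrable (D `&` phi @^-1` (F n)) (EFin \o f),
      forall n, nu.-integrable (F n) (EFin \o h) &
      forall n E, measurable E -> E `<=` F n ->
        (\int[nu]_(z in E) (h z)%:E = \int[tau]_(x in D `&` phi @^-1` E) (f x)%:E)%E].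

Hypotheses (mD : measurable D) (mphi : measurable_fun setT phi).
Hypothesis nuE : forall E, measurable E -> nu E = tau (D `&` phi @^-1` E).
Hypotheses (mF : forall n, measurable (F n)) (F_cover : \bigcup_n F n = setT).
Hypothesis F_fin : forall n, (nu (F n) < +oo)%E.

Let mfiber := measurable_fiber mD mphi.

Lemma ae_cover (P : Z -> Prop) :
  (forall n, {ae nu, forall z, F n z -> P z}) -> {ae nu, forall z, P z}.
Proof.
move=> FP; have : {ae nu, forall z, forall n, F n z -> P z} by exact: ae_foralln.
apply: filterS => z Pz.
have : (\bigcup_n F n) z by rewrite F_cover.
by move=> [n _ /Pz].
Qed.

(** Comparison with constants later yields the L^oo bound and, with [c = 0], the vanishing of
    imaginary parts. *)
Lemma condexp_cst (c : R) : condexp (cst c) (cst c).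
Proof.
have cE E : measurable E -> (\int[nu]_(z in E) (cst c z)%:E =
    \int[tau]_(x in D `&` phi @^-1` E) (cst c x)%:E)%E.
  move=> mE; rewrite [LHS](@integral_cst _ _ _ nu _ mE c%:E).
  by rewrite [RHS](@integral_cst _ _ _ tau _ (mfiber mE) c%:E) nuE.
have nF n : nu.-integrable (F n) (EFin \o cst c).
  apply/integrableP; split; first exact/measurable_EFinP/measurable_cst.
  rewrite [ltLHS](@integral_cst _ _ _ nu _ (mF n) `|c|%:E).
  by rewrite lte_mul_pinfty ?lee_fin.
split => // [n|n E mE _]; last exact: cE.
have := integrable_fiber mD mphi nuE (mF n) (nF n); exact.
Qed.

Lemma condexp_lin (a b : R) f1 f2 h1 h2 : condexp f1 h1 -> condexp f2 h2 ->
  condexp (fun x => a * f1 x + b * f2 x) (fun z => a * h1 z + b * h2 z).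
Proof.
move=> [mh1 if1 ih1 fh1] [mh2 if2 ih2 fh2].
have linI d (T : measurableType d) (mu : {measure set T -> \bar R}) A (u v : T -> R) :
    measurable A -> mu.-integrable A (EFin \o u) -> mu.-integrable A (EFin \o v) ->
    mu.-integrable A (EFin \o (fun x => a * u x + b * v x)) /\
    (\int[mu]_(x in A) (a * u x + b * v x)%:E =
      a%:E * \int[mu]_(x in A) (u x)%:E + b%:E * \int[mu]_(x in A) (v x)%:E)%E.
  move=> mA iu iv.
  have iau := @integrableZl _ _ _ mu _ mA a _ iu.
  have ibv := @integrableZl _ _ _ mu _ mA b _ iv.
  split; first exact: (integrableD mA iau ibv).
  transitivity (\int[mu]_(x in A) (a%:E * (u x)%:E + b%:E * (v x)%:E))%E.
    exact: eq_integral.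
  by rewrite (integralD mA iau ibv) !integralZl.
split.
- by apply: measurable_funD; apply: measurable_funM.
- by move=> n; have [] := linI _ _ tau _ _ _ (mfiber (mF n)) (if1 n) (if2 n).
- by move=> n; have [] := linI _ _ nu _ _ _ (mF n) (ih1 n) (ih2 n).
move=> n E mE EF.
have sub : D `&` phi @^-1` E `<=` D `&` phi @^-1` F n by move=> x [Dx /EF].
have [_ ->] := linI _ _ nu E h1 h2 mE (integrableS (mF n) mE EF (ih1 n))
  (integrableS (mF n) mE EF (ih2 n)).
have [_ ->] := linI _ _ tau _ f1 f2 (mfiber mE)
  (integrableS (mfiber (mF n)) (mfiber mE) sub (if1 n))
  (integrableS (mfiber (mF n)) (mfiber mE) sub (if2 n)).
by rewrite (fh1 n)// (fh2 n).
Qed.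

Lemma condexp_ae f f' h h' : measurable_fun setT f' -> measurable_fun setT h' ->
  {ae tau, forall x, f x = f' x} -> {ae nu, forall z, h z = h' z} ->
  condexp f h -> condexp f' h'.
Proof.
move=> mf' mh' ff' hh' [mh if_ ih fh].
have aeI d (T : measurableType d) (mu : {measure set T -> \bar R}) A (u v : T -> R) :
    measurable A -> measurable_fun setT v -> {ae mu, forall x, u x = v x} ->
    mu.-integrable A (EFin \o u) -> mu.-integrable A (EFin \o v) /\
    (\int[mu]_(x in A) (u x)%:E = \int[mu]_(x in A) (v x)%:E)%E.
  move=> mA mv uv iu.
  have mv' : measurable_fun A (EFin \o v).
    by apply/measurable_EFinP; exact: measurable_funTS.
  have aeuv : ae_eq mu A (EFin \o u) (EFin \o v).
    by apply: filterS uv => x /= ->.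
  split; first exact: (ae_eq_integrable mA mv' aeuv iu).
  apply: ae_eq_integral => //; exact: measurable_int iu.
have sub n E : E `<=` F n -> D `&` phi @^-1` E `<=` D `&` phi @^-1` F n.
  by move=> EF x [Dx /EF].
split => // [n|n|n E mE EF].
- by have [] := aeI _ _ tau _ f f' (mfiber (mF n)) mf' ff' (if_ n).
- by have [] := aeI _ _ nu _ h h' (mF n) mh' hh' (ih n).
have [_ <-] := aeI _ _ nu _ h h' mE mh' hh' (integrableS (mF n) mE EF (ih n)).
have [_ <-] := aeI _ _ tau _ f f' (mfiber mE) mf' ff'
  (integrableS (mfiber (mF n)) (mfiber mE) (sub _ _ EF) (if_ n)).
exact: fh mE EF.
Qed.

(** Over the part of [F n] where [h] is negative, its integral equals an integral of [f], hence is
    non-negative; so [h] vanishes almost everywhere on that part, which is therefore null. *)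
Lemma condexp_ge0 f h : condexp f h -> {ae tau, forall x, 0 <= f x} ->
  {ae nu, forall z, 0 <= h z}.
Proof.
move=> [mh if_ ih fh] f0; apply: ae_cover => n.
pose A := F n `&` [set z | h z < 0].
have mA : measurable A.
  apply: measurableI => //; rewrite -[X in measurable X]setTI.
  rewrite (_ : [set z | h z < 0] = h @^-1` `]-oo, 0[%classic).
    exact: mh.
  by apply/seteqP; split => z /=; rewrite in_itv.
have AF : A `<=` F n by move=> z [].
have iA : nu.-integrable A (EFin \o h) by exact: integrableS (ih n).
have mpA := mfiber mA.
have ge0 : (0 <= \int[nu]_(z in A) (h z)%:E)%E.
  rewrite (fh n)//.
  have mf : measurable_fun (D `&` phi @^-1` A) (EFin \o f).
    apply: measurable_funS (measurable_int _ (if_ n)); first exact: mfiber.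
    by move=> x [Dx /AF].
  (* [f] is non-negative only almost everywhere, hence the passage to its modulus. *)
  rewrite (ae_eq_integral (fun x => `|(f x)%:E|%E))//.
  - exact: integral_ge0.
  - exact: measurableT_comp.
  by apply: filterS f0 => x fx _; rewrite /= ger0_norm.
have : (\int[nu]_(z in A) `|(EFin \o h) z| = 0)%E.
  apply/eqP; rewrite eq_le integral_ge0// andbT.
  rewrite (eq_integral (fun z => - (EFin \o h) z)%E); last first.
    by move=> z /[!inE] -[_ /= hz]; rewrite ler0_norm ?EFinN// ltW.
  rewrite integralN; last exact: integrable_add_def.
  by rewrite oppe_le0.
move/(ae_eq_integral_abs nu mA (measurable_int _ iA)).
apply: filterS => z hz Fz; rewrite leNgt; apply/negP => hz0.
have /hz : A z by [].
by move=> -[hz']; rewrite hz' ltxx in hz0.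
Qed.

Lemma condexp_le f g h k : condexp f h -> condexp g k ->
  {ae tau, forall x, f x <= g x} -> {ae nu, forall z, h z <= k z}.
Proof.
move=> fh gk fg; have := condexp_ge0 (condexp_lin (-1) 1 fh gk).
rewrite /= => H; have : {ae tau, forall x, 0 <= -1 * f x + 1 * g x}.
  by apply: filterS fg => x; lra.
by move/H; apply: filterS => z; lra.
Qed.

Lemma condexp_uniq f h k : condexp f h -> condexp f k ->
  {ae nu, forall z, h z = k z}.
Proof.
move=> fh fk.
have ff : {ae tau, forall x, f x <= f x} by apply: nearW.
have := condexp_le fh fk ff; have := condexp_le fk fh ff.
by apply: filterS2 => z ? ?; apply/eqP; rewrite eq_le; apply/andP.
Qed.

(** Radon-Nikodym theorem for the image [kc] under [phi] of the charge with density [f] on [A],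
    relative to the finite measure [nun], the restriction of [nu] to [F n]. *)
Let condexp_local n (f : S -> R) :
  tau.-integrable (D `&` phi @^-1` (F n)) (EFin \o f) ->
  exists h : Z -> R, [/\ measurable_fun setT h, nu.-integrable (F n) (EFin \o h) &
    forall E, measurable E -> E `<=` F n ->
      (\int[nu]_(z in E) (h z)%:E = \int[tau]_(x in D `&` phi @^-1` E) (f x)%:E)%E].
Proof.
set A := D `&` _ => iA; have mA : measurable A by exact: mfiber.
pose g := (EFin \o f) \_ A.
have ig : tau.-integrable setT g by apply/(integrable_mkcond _ mA).1.
pose k := pushforward (induced_charge ig) phi.
have kE E : k E = (\int[tau]_(x in phi @^-1` E `&` A) (f x)%:E)%E.
  by rewrite /k /pushforward /induced_charge [RHS]integral_mkcondr.
pose nun : {finite_measure set Z -> \bar R} := mfrestr (mF n) (F_fin n).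
have mphiE E : measurable E -> measurable (phi @^-1` E).
  by move=> mE; rewrite -[X in measurable X]setTI; exact: mphi.
pose kc0 : {charge set Z -> \bar R} := pushforward (induced_charge ig) phi.
pose kc := kc0 mphi.
(* Absolute continuity: if the part of [E] inside [F n] is null for [nu], its fiber in [D], the only
   place where [kc E] collects mass, is null for [tau]. *)
have knu : kc `<< nun.
  apply/null_content_dominatesP => E mE.
  rewrite [LHS](nuE (measurableI _ _ mE (mF n))) => E0.
  rewrite [LHS]kE null_set_integral//.
  - by apply: measurableI => //; exact: mphiE.
  - apply: measurable_funS (measurable_int _ iA) => //; exact: subIsetr.
  - by rewrite -E0; congr (tau _); rewrite /A preimage_setI setICA.
have fin := Radon_Nikodym_fin_num _ knu.
pose h z := fine (Radon_Nikodym kc nun z).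
have hE : EFin \o h = Radon_Nikodym kc nun.
  by apply/funext => z; rewrite /= fineK// fin.
have ih := Radon_Nikodym_integrable knu.
have mh : measurable_fun setT h.
  by apply/measurable_EFinP; rewrite hE; exact: measurable_int ih.
have nunE E u : E `<=` F n -> (\int[nu]_(z in E) u z = \int[nun]_(z in E) u z)%E.
  move=> EF; apply: eq_measure_integral => B mB BE.
  by rewrite /= /mfrestr /mrestr setIidl// => z /BE /EF.
exists h; split => //.
  apply/integrableP; split; first by apply/measurable_EFinP; exact: measurable_funTS.
  rewrite nunE// hE.
  by have /integrableP[] := integrableS measurableT (mF n) (@subsetT _ _) ih.
move=> E mE EF; rewrite nunE// -[LHS]/(\int[nun]_(z in E) (EFin \o h) z)%E hE.
rewrite -Radon_Nikodym_integral// [LHS]kE; congr (integral _ _ _).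
by apply/seteqP; split => x /=; [move=> [? []]|move=> [? Ex]; do !split => //; exact: EF].
Qed.

(* The local densities agree almost everywhere on overlaps, so they can be
   glued along any measurable choice of an index [i z] with [F (i z) z]. *)
Lemma condexp_exists (f : S -> R) :
  (forall n, tau.-integrable (D `&` phi @^-1` (F n)) (EFin \o f)) ->
  exists h, condexp f h.
Proof.
move=> if_; have [h_ h_P] := choice (fun n => condexp_local (if_ n)).
(* The pieces [seqDU F n] are disjoint, so each is exactly a level set of [i]; this makes [i]
   measurable. *)
have /choice[i iP] : forall z, exists n, seqDU F n z.
  move=> z; have : (\bigcup_n seqDU F n) z by rewrite -seqDU_bigcup_eq F_cover.
  by move=> [n _ ?]; exists n.
have iE n : i @^-1` [set n] = seqDU F n.
  apply/seteqP; split => z /=; first by move=> <-.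
  by move=> Fnz; apply: (@trivIset_seqDU _ F) => //; exists z.
have mi n : measurable (i @^-1` [set n]).
  by rewrite iE; apply: measurableD => //; exact: bigsetU_measurable.
pose h z := h_ (i z) z.
have mh : measurable_fun setT h.
  move=> _ B mB; rewrite setTI.
  rewrite (_ : _ @^-1` _ = \bigcup_n (i @^-1` [set n] `&` h_ n @^-1` B)); last first.
    apply/seteqP; split => z /=; first by exists (i z).
    by move=> [n _ [/= <-]].
  apply: bigcupT_measurable => n; apply: measurableI => //.
  by have [mhn _ _] := h_P n; rewrite -[X in measurable X]setTI; exact: mhn.
(* On the intersection of [F m] and [F n], both densities have the same integral over every
   measurable subset. *)
have overlap : {ae nu, forall z, forall m n, F m z -> F n z -> h_ m z = h_ n z}.
  apply: ae_foralln => m; apply: ae_foralln => n.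
  have [mhm ihm hmE] := h_P m; have [mhn ihn hnE] := h_P n.
  have mmn : measurable (F m `&` F n) by exact: measurableI.
  have : ae_eq nu (F m `&` F n) (EFin \o h_ m) (EFin \o h_ n).
    apply: integral_ae_eq => //.
    - by apply: integrableS ihm.
    - by apply/measurable_EFinP; exact: measurable_funTS.
    - by move=> E EF mE; rewrite [LHS]hmE ?[RHS]hnE// => z /EF[].
  by apply: filterS => z hz Fm Fn; case: (hz (conj Fm Fn)).
have hF n : {ae nu, forall z, F n z -> h z = h_ n z}.
  by apply: filterS overlap => z hz; apply: hz; have [] := iP z.
exists h; split => // n.
  have [mhn ihn hnE] := h_P n.
  apply: (ae_eq_integrable (mF n) _ _ ihn).
    by apply/measurable_EFinP; exact: measurable_funTS.
  by apply: filterS (hF n) => z hz /hz /= ->.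
move=> E mE EF; have [mhn ihn hnE] := h_P n.
rewrite -hnE//; apply: ae_eq_integral => //.
- by apply/measurable_EFinP; exact: measurable_funTS.
- by apply/measurable_EFinP; exact: measurable_funTS.
- by apply: filterS (hF n) => z hz /EF/hz /= ->.
Qed.

(** [h] is non-negative almost everywhere, and its integral agrees with that of [f] over each
    disjoint piece of the cover; summing gives the integral of [f] over [D], at most the one over
    the whole space. *)
Lemma condexp_integral_abs f h : condexp f h -> measurable_fun setT f ->
  (forall x, 0 <= f x) ->
  (\int[nu]_z `|(h z)%:E| <= \int[tau]_x (f x)%:E)%E.
Proof.
move=> fh mf f0; have [mh _ ih hE] := fh.
have mG n : measurable (seqDU F n).
  by apply: measurableD => //; exact: bigsetU_measurable.
have GF n : seqDU F n `<=` F n by move=> z [].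
have mnh : measurable_fun setT (fun z => `|(h z)%:E|%E).
  by apply: measurableT_comp => //; exact/measurable_EFinP.
have mfE : measurable_fun setT (EFin \o f) by exact/measurable_EFinP.
have h0 : {ae nu, forall z, 0 <= h z} by apply: (condexp_ge0 fh); exact: nearW.
have G_cover : \bigcup_n seqDU F n = setT by rewrite -seqDU_bigcup_eq.
rewrite -{1}G_cover ge0_integral_bigcup//; last exact: measurable_funTS.
apply: (@le_trans _ _ (\int[tau]_(x in D) (f x)%:E)%E); last first.
  by apply: ge0_subset_integral => // x _; rewrite lee_fin.
have -> : D = \bigcup_n (D `&` phi @^-1` seqDU F n).
  by rewrite -setI_bigcupr -preimage_bigcup G_cover preimage_setT setIT.
rewrite ge0_integral_bigcup//.
- apply: lee_nneseries => [n _ _|n _]; first exact: integral_ge0.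
  rewrite -(hE n)// le_eqVlt; apply/orP; left; apply/eqP.
  have mGh : measurable_fun (seqDU F n) (EFin \o h).
    by apply/measurable_EFinP; exact: measurable_funTS.
  apply: ae_eq_integral => //; first exact: measurable_funTS.
  by apply: filterS h0 => z hz _; rewrite /= ger0_norm.
- by move=> n; exact: mfiber.
- exact: measurable_funTS.
- by move=> x _; rewrite lee_fin.
- apply/trivIsetP => m n _ _ mn; apply/seteqP; split => // x [[_ Fm] [_ Fn]].
  have /trivIsetP/(_ m n I I mn) := @trivIset_seqDU _ F.
  by move=> /seteqP[+ _] => /(_ (phi x)); apply.
Qed.

End conditional_expectation.

(** * Complex-valued functions and classes in L^1 + L^oo *)

Section complex_Lebesgue.
Context d (T : measurableType d) (R : realType) (mu : {measure set T -> \bar R}).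
Implicit Types (f : T -> R[i]) (q r : L1Linfty mu).

Lemma normc_ge0 (z : R[i]) : 0 <= Normc.normc z.
Proof. by case: z => a b; exact: sqrtr_ge0. Qed.

Lemma normr_Re_le (z : R[i]) : `|complex.Re z| <= Normc.normc z.
Proof.
by case: z => a b /=; rewrite -sqrtr_sqr ler_wsqrtr// lerDl sqr_ge0.
Qed.

Lemma normr_Im_le (z : R[i]) : `|complex.Im z| <= Normc.normc z.
Proof.
by case: z => a b /=; rewrite -sqrtr_sqr ler_wsqrtr// lerDr sqr_ge0.
Qed.

Lemma cLnorm1E f : cLnorm mu 1%E f = (\int[mu]_x (Normc.normc (f x))%:E)%E.
Proof.
by rewrite /cLnorm Lnorm1; apply: eq_integral => x _; rewrite gee0_abs// lee_fin normc_ge0.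
Qed.

Lemma cLnormyP f (M : R) : 0 <= M ->
  (cLnorm mu +oo%E f <= M%:E)%E <-> {ae mu, forall x, Normc.normc (f x) <= M}.
Proof.
move=> M0; rewrite /cLnorm unlock; case: ifPn => mu0.
  split => [/ess_supP|H].
    by apply: filterS => x; rewrite /= ger0_norm ?normc_ge0.
  by apply/ess_supP; apply: filterS H => x; rewrite /= ger0_norm ?normc_ge0.
(* If the whole space is null, the norm is [0] by convention, whence the use of [0 <= M], and every
   property holds almost everywhere. *)
split => _; last by rewrite lee_fin.
exists setT; split => //.
by apply/eqP; rewrite eq_le measure_ge0 andbT leNgt.
Qed.

Lemma L1Linfty_in q : (q : T -> R[i]) \in cL1Linfty mu.
Proof. exact: (valP (repr q)). Qed.

Lemma cL1LinftyP f : f \in cL1Linfty mu <->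
  exists g h, [/\ cLfun mu 1%E g, cLfun mu +oo%E h & f = g + h].
Proof. by rewrite inE. Qed.

Lemma cL1Linfty_cmeasurable f : f \in cL1Linfty mu -> cmeasurable f.
Proof. by move=> /cL1LinftyP[g [h [[mg _] [mh _] ->]]]; exact: cmeasurableD. Qed.

(** For [p = +oo] the modulus is dominated almost everywhere by the constant [cLnorm mu +oo f],
    which is integrable over a set of finite measure. *)
Lemma cLfun_normc_integrable p f A : p = 1%E \/ p = +oo%E -> cLfun mu p f ->
  measurable A -> (mu A < +oo)%E ->
  mu.-integrable A (fun x => (Normc.normc (f x))%:E).
Proof.
move=> p1y [mf nf] mA Afin; have mnf := cmeasurable_normc mf.
apply/integrableP; split; first by apply/measurable_EFinP; exact: measurable_funTS.
under eq_integral do rewrite gee0_abs ?lee_fin ?normc_ge0//.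
case: p1y nf => -> nf.
  apply: le_lt_trans nf; rewrite cLnorm1E ge0_subset_integral//.
  - exact/measurable_EFinP.
  - by move=> x _; rewrite lee_fin normc_ge0.
have nf0 : (0 <= cLnorm mu +oo%E f)%E by exact: Lnorm_ge0.
have /cLnormyP fM : (cLnorm mu +oo%E f <= (fine (cLnorm mu +oo%E f))%:E)%E.
  by rewrite fineK// ge0_fin_numE.
apply: (@le_lt_trans _ _ (\int[mu]_(x in A) (fine (cLnorm mu +oo%E f))%:E)%E).
  apply: ae_ge0_le_integral => //.
  - by move=> x _; rewrite lee_fin normc_ge0.
  - by apply/measurable_EFinP; exact: measurable_funTS.
  - by move=> x _; rewrite lee_fin fine_ge0.
  by apply: filterS (fM (fine_ge0 nf0)) => x ? _; rewrite lee_fin.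
by rewrite integral_cst// lte_mul_pinfty ?lee_fin ?fine_ge0.
Qed.

Lemma normc_integrable_ReIm f A : measurable A -> cmeasurable f ->
  mu.-integrable A (fun x => (Normc.normc (f x))%:E) ->
  mu.-integrable A (EFin \o (fun x => complex.Re (f x))) /\
  mu.-integrable A (EFin \o (fun x => complex.Im (f x))).
Proof.
move=> mA [mr mi] nf; split; apply: (le_integrable mA _ _ nf).
- by apply/measurable_EFinP; exact: measurable_funTS.
- by move=> x _; rewrite !abse_EFin lee_fin [leRHS]ger0_norm ?normc_ge0// normr_Re_le.
- by apply/measurable_EFinP; exact: measurable_funTS.
- by move=> x _; rewrite !abse_EFin lee_fin [leRHS]ger0_norm ?normc_ge0// normr_Im_le.
Qed.

Lemma L1Linfty_of_fun f : f \in cL1Linfty mu ->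
  exists q : L1Linfty mu, {ae mu, forall x, q x = f x}.
Proof.
by move=> fL; exists (\pi_(L1Linfty mu)%qT (exist _ f fL)); exact: L1Linfty_pi_ae.
Qed.

(** The representative chosen for a combination of classes is tied to the chosen representatives of
    its terms only up to a null set. *)
Lemma L1Linfty_lin_ae a q r :
  {ae mu, forall x, (a *: q + r : L1Linfty mu) x = a * q x + r x}.
Proof.
have -> : a *: q + r = \pi_(L1Linfty mu)%qT (a *: repr q + repr r).
  by rewrite L1Linfty_piD reprK.
have := L1Linfty_pi_ae (a *: repr q + repr r); apply: filterS => x ->.
by rewrite L1LinftyFunD L1LinftyFunZ.
Qed.

Lemma eq_LpNorm p q f : p = 1%E \/ p = +oo%E -> {ae mu, forall x, q x = f x} ->
  cmeasurable f -> LpNorm p q = cLnorm mu p f.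
Proof.
move=> p1y qf mf; have mq := cL1Linfty_cmeasurable (L1Linfty_in q).
case: p1y => ->; rewrite /LpNorm.
  rewrite !cLnorm1E; apply: ae_eq_integral => //.
  - by apply/measurable_EFinP; exact: cmeasurable_normc.
  - by apply/measurable_EFinP; exact: cmeasurable_normc.
  by apply: filterS qf => x -> _.
rewrite /cLnorm unlock; case: ifPn => // _; apply: eq_ess_sup.
by apply: filterS qf => x /= ->.
Qed.

End complex_Lebesgue.

(** * Linear maps from functional relations *)

Section linear_map_of_relation.
Context (K : pzRingType) (U V : lmodType K) (rel : U -> V -> Prop).
Hypothesis rel_total : forall u, exists v, rel u v.
Hypothesis rel_lin : forall a u1 u2 v1 v2, rel u1 v1 -> rel u2 v2 ->
  rel (a *: u1 + u2) (a *: v1 + v2).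
Hypothesis rel_uniq : forall u v1 v2, rel u v1 -> rel u v2 -> v1 = v2.

(** A choice function for [rel] is linear because both sides of the linearity equation are related
    to the same element. This turns almost-everywhere descriptions into operators on classes. *)
Lemma linear_of_rel : exists A : {linear U -> V}, forall u, rel u (A u).
Proof.
have /choice[A AP] := rel_total.
have linA : linear A by move=> a u v; apply: (rel_uniq (AP _)); exact: rel_lin.
pose A' := GRing.isLinear.Build K U V *:%R A linA.
pose AL : {linear U -> V} := HB.pack A A'.
by exists AL.
Qed.

End linear_map_of_relation.

(** * The complex modulus through countably many rational directions *)

Lemma ae_forall_countable d (T : measurableType d) (R : realType)
    (mu : {measure set T -> \bar R}) (I : countType) (P : I -> T -> Prop) :
  (forall i, {ae mu, forall x, P i x}) -> {ae mu, forall x, forall i, P i x}.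
Proof.
move=> aeP.
have : {ae mu, forall x, forall n i, unpickle n = Some i -> P i x}.
  apply: ae_foralln => n; case: (unpickle n) => [i|]; last exact: nearW.
  by apply: filterS (aeP i) => x Px _ [<-].
by apply: filterS => x Px i; apply: (Px (pickle i)); rewrite pickleK.
Qed.

Section normc_rational_directions.
Variable R : realType.

Lemma normc_le_ReIm (z : R[i]) : Normc.normc z <= `|complex.Re z| + `|complex.Im z|.
Proof.
case: z => a b /=; rewrite -[leRHS]ger0_norm ?addr_ge0// -sqrtr_sqr ler_wsqrtr//.
by rewrite sqrrD !real_normK ?num_real// lerD2r lerDl mulrn_wge0// mulr_ge0.
Qed.

Lemma dot_le_normc (a b : R) (z : R[i]) :
  a * complex.Re z + b * complex.Im z <= Num.sqrt (a ^+ 2 + b ^+ 2) * Normc.normc z.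
Proof.
case: z => x y /=; apply: le_trans (ler_norm _) _.
rewrite -sqrtr_sqr -sqrtrM ?addr_ge0 ?sqr_ge0// ler_wsqrtr//.
(* Lagrange's identity: the difference of the two squares is exactly [(a * y - b * x) ^+ 2]. *)
rewrite -subr_ge0; apply: le_trans (sqr_ge0 (a * y - b * x)) _.
by rewrite le_eqVlt; apply/orP; left; apply/eqP; ring.
Qed.

(** The direction of [z] itself would give [|z|^2 <= |z| k]; rational directions close enough to it
    lead to the same conclusion. *)
Lemma normc_le_rational (z : R[i]) (k : R) :
  (forall p q : rat, ratr p * complex.Re z + ratr q * complex.Im z <=
     Num.sqrt (ratr p ^+ 2 + ratr q ^+ 2) * k) ->
  Normc.normc z <= k.
Proof.
move=> H; set r := Normc.normc z.
(* The directions [1] and [-1] bound both [Re z] and [- Re z] by [k]. *)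
have k0 : 0 <= k.
  have := H 1 0; have := H (-1) 0.
  rewrite rmorphN !rmorph1 !rmorph0 sqrrN !expr1n expr0n/= !addr0 !sqrtr1; lra.
rewrite leNgt; apply/negP => kr.
have r0 : 0 < r by exact: le_lt_trans kr.
have rk : 0 < r + k by rewrite ltr_wpDr.
(* Approximating both coordinates within [e] gives [r ^+ 2 - 2 * e * r <= (r + 2 * e) * k], that is
   [r * (r - k) <= 2 * e * (r + k)]; this [e] makes the right side half of the left one. *)
have [e e0 eE] : exists2 e, 0 < e & e * (4 * (r + k)) = r * (r - k).
  exists (r * (r - k) / (4 * (r + k))).
    by rewrite divr_gt0// mulr_gt0// subr_gt0.
  by rewrite divfK// mulf_neq0// gt_eqF.
have near (x : R) : exists p : rat, `|ratr p - x| < e.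
  have xe : x - e < x + e by lra.
  have [p] := rat_in_itvoo xe.
  by rewrite in_itv/= => /andP[? ?]; exists p; rewrite ltr_norml; apply/andP; split; lra.
have [p px] := near (complex.Re z); have [q qy] := near (complex.Im z).
have {H} := H p q.
set a : R := ratr p in px *; set b : R := ratr q in qy *.
set x := complex.Re z in px *; set y := complex.Im z in qy *.
have xr : `|x| <= r by exact: normr_Re_le.
have yr : `|y| <= r by exact: normr_Im_le.
have ab : Num.sqrt (a ^+ 2 + b ^+ 2) <= r + 2 * e.
  have -> : Num.sqrt (a ^+ 2 + b ^+ 2) = Normc.normc ((x +i* y) + ((a - x) +i* (b - y)))%C.
    by rewrite /GRing.add/= /Normc.normc !subrKC.
  apply: le_trans (le_normcD _ _) _.
  have -> : (x +i* y)%C = z by rewrite /x /y; case: (z).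
  rewrite lerD2l; apply: le_trans (normc_le_ReIm _) _ => /=; lra.
have xy2 : x ^+ 2 + y ^+ 2 = r ^+ 2.
  by rewrite /r /x /y; case: (z) => u v /=; rewrite sqr_sqrtr// addr_ge0 ?sqr_ge0.
have lower : r ^+ 2 - 2 * e * r <= a * x + b * y.
  have h (u v : R) : `|v| <= r -> `|u - v| < e -> v ^+ 2 - e * r <= u * v.
    move=> vr uv; have -> : u * v = v ^+ 2 + (u - v) * v by ring.
    rewrite lerD2l lerNl; apply: le_trans (ler_norm _) _.
    by rewrite normrN normrM ler_pM// ltW.
  by have := h _ _ xr px; have := h _ _ yr qy; lra.
move=> upper.
have : r ^+ 2 - 2 * e * r <= (r + 2 * e) * k.
  apply: le_trans lower (le_trans upper _); exact: ler_wpM2r.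
have : 0 < r * (r - k) by rewrite mulr_gt0// subr_gt0.
nra.
Qed.

End normc_rational_directions.

(** * Complex conditional expectation *)

Section complex_conditional_expectation.
Context dS dZ (S : measurableType dS) (Z : measurableType dZ) (R : realType).
Variables (tau : {measure set S -> \bar R}) (nu : {measure set Z -> \bar R}).
Variables (D : set S) (phi : S -> Z) (F : (set Z)^nat).

Definition ccondexp (f : S -> R[i]) (h : Z -> R[i]) : Prop :=
  condexp tau nu D phi F (fun x => complex.Re (f x)) (fun z => complex.Re (h z)) /\
  condexp tau nu D phi F (fun x => complex.Im (f x)) (fun z => complex.Im (h z)).

Hypotheses (mD : measurable D) (mphi : measurable_fun setT phi).
Hypothesis nuE : forall E, measurable E -> nu E = tau (D `&` phi @^-1` E).
Hypotheses (mF : forall n, measurable (F n)) (F_cover : \bigcup_n F n = setT).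
Hypothesis F_fin : forall n, (nu (F n) < +oo)%E.

Lemma ccondexp_lin (a : R[i]) f1 f2 h1 h2 : ccondexp f1 h1 -> ccondexp f2 h2 ->
  ccondexp (fun x => a * f1 x + f2 x) (fun z => a * h1 z + h2 z).
Proof.
case: a => a b [r1 i1] [r2 i2].
have lin := @condexp_lin _ _ _ _ R tau nu D phi F mD mphi mF.
split.
- have := lin 1 1 _ _ _ _ (lin a (- b) _ _ _ _ r1 i1) r2.
  by congr condexp; apply/funext => x; case: (_ x) => ? ?; case: (_ x) => ? ? /=; ring.
- have := lin 1 1 _ _ _ _ (lin a b _ _ _ _ i1 r1) i2.
  by congr condexp; apply/funext => x; case: (_ x) => ? ?; case: (_ x) => ? ? /=; ring.
Qed.

Lemma ccondexp_ae f f' h h' : cmeasurable f' -> cmeasurable h' ->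
  {ae tau, forall x, f x = f' x} -> {ae nu, forall z, h z = h' z} ->
  ccondexp f h -> ccondexp f' h'.
Proof.
move=> [mrf mif] [mrh mih] ff hh [fhr fhi]; split.
- apply: (condexp_ae mD mphi mF _ _ _ _ fhr) => //.
    by apply: filterS ff => x ->.
  by apply: filterS hh => x ->.
- apply: (condexp_ae mD mphi mF _ _ _ _ fhi) => //.
    by apply: filterS ff => x ->.
  by apply: filterS hh => x ->.
Qed.

Lemma ccondexp_uniq f h k : ccondexp f h -> ccondexp f k ->
  {ae nu, forall z, h z = k z}.
Proof.
move=> [hr hi] [kr ki].
have := condexp_uniq mD mphi mF F_cover hr kr.
have := condexp_uniq mD mphi mF F_cover hi ki.
by apply: filterS2 => z; case: (h z) => ? ?; case: (k z) => ? ? /= -> ->.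
Qed.

Lemma ccondexp_ge0 f h : ccondexp f h -> {ae tau, forall x, 0 <= f x} ->
  {ae nu, forall z, 0 <= h z}.
Proof.
move=> [hr hi] f0.
have := condexp_cst mD mphi nuE mF F_fin 0 => c0.
have r0 := condexp_ge0 mD mphi mF F_cover hr.
have {}r0 : {ae nu, forall z, 0 <= complex.Re (h z)}.
  by apply: r0; apply: filterS f0 => x; case: (f x) => u v /= /andP[].
(* In the order on [R[i]], a non-negative number has imaginary part [0]; comparing with the constant
   [0] from both sides preserves this. *)
have i0 : {ae nu, forall z, complex.Im (h z) <= 0}.
  apply: (condexp_le mD mphi mF F_cover hi c0).
  by apply: filterS f0 => x; case: (f x) => u v /= /andP[/eqP ->].
have i1 : {ae nu, forall z, 0 <= complex.Im (h z)}.
  apply: (condexp_le mD mphi mF F_cover c0 hi).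
  by apply: filterS f0 => x; case: (f x) => u v /= /andP[/eqP ->].
apply: filterS3 r0 i0 i1 => z; case: (h z) => u v /= u0 v0 v1.
by rewrite lecE/= u0 andbT eq_le v0 v1.
Qed.

(** In each rational direction the bound is a linear inequality between real functions, preserved by
    [condexp_le]; the countably many exceptional null sets are discarded together. *)
Lemma ccondexp_normc f h : cmeasurable f -> ccondexp f h ->
  exists k, condexp tau nu D phi F (fun x => Normc.normc (f x)) k /\
    {ae nu, forall z, Normc.normc (h z) <= k z}.
Proof.
move=> mf [hr hi].
have mfiber n := measurable_fiber mD mphi (mF n).
have [k kP] : exists k, condexp tau nu D phi F (fun x => Normc.normc (f x)) k.
  apply: condexp_exists => // n.
  have [_ ir _ _] := hr; have [_ ii _ _] := hi.
  have := integrableD (mfiber n) (integrable_abse (ir n)) (integrable_abse (ii n)).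
  apply: le_integrable => //.
    by apply/measurable_EFinP; apply: measurable_funTS; exact: cmeasurable_normc.
  move=> x _ /=; rewrite lee_fin [leLHS]ger0_norm ?normc_ge0// [leRHS]ger0_norm ?addr_ge0//.
  exact: normc_le_ReIm.
exists k; split => //.
(* The idle term [0 * k z] gives the right side the form of a linear combination as in
   [condexp_lin]. *)
have : {ae nu, forall z, forall pq : rat * rat,
    ratr pq.1 * complex.Re (h z) + ratr pq.2 * complex.Im (h z) <=
    Num.sqrt (ratr pq.1 ^+ 2 + ratr pq.2 ^+ 2) * k z + 0 * k z}.
  apply: ae_forall_countable => -[p q] /=.
  have lin := @condexp_lin _ _ _ _ R tau nu D phi F mD mphi mF.
  apply: (condexp_le mD mphi mF F_cover (lin _ _ _ _ _ _ hr hi) (lin _ _ _ _ _ _ kP kP)).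
  by apply: nearW => x; rewrite mul0r addr0; exact: dot_le_normc.
apply: filterS => z H; apply: normc_le_rational => p q.
by have := H (p, q); rewrite mul0r addr0.
Qed.

(** The majorant [k] of the modulus reduces both cases to real functions: it is integrated for
    [p = 1] and compared with the constant [cLnorm tau +oo f] for [p = +oo]. *)
Lemma ccondexp_cLnorm p f h : p = 1%E \/ p = +oo%E -> cmeasurable f ->
  ccondexp f h -> (cLnorm nu p h <= cLnorm tau p f)%E.
Proof.
move=> p1y mf fh; have [k [fk hk]] := ccondexp_normc mf fh.
have mnf := cmeasurable_normc mf.
have mh : cmeasurable h by case: fh => -[mr _ _ _] [mi _ _ _].
have mk : measurable_fun setT k by case: fk.
case: p1y => ->.
  rewrite !cLnorm1E.
  apply: le_trans (condexp_integral_abs mD mphi mF F_cover fk mnf _); last first.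
    by move=> x; exact: normc_ge0.
  apply: ae_ge0_le_integral => //.
  - by move=> z _; rewrite lee_fin normc_ge0.
  - by apply/measurable_EFinP; exact: cmeasurable_normc.
  - by apply: measurableT_comp => //; exact/measurable_EFinP.
  - by apply: filterS hk => z hz _; rewrite lee_fin (le_trans hz)// ler_norm.
have nf0 : (0 <= cLnorm tau +oo%E f)%E by exact: Lnorm_ge0.
have [->|fy] := eqVneq (cLnorm tau +oo%E f) +oo%E; first by rewrite leey.
have /fineK fE : cLnorm tau +oo%E f \is a fin_num by rewrite ge0_fin_numE// lt_neqAle fy leey.
rewrite -fE; apply/cLnormyP; rewrite ?fine_ge0//.
have fM : {ae tau, forall x, Normc.normc (f x) <= fine (cLnorm tau +oo%E f)}.
  by apply/cLnormyP; rewrite ?fine_ge0// fE.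
have := condexp_le mD mphi mF F_cover fk (condexp_cst mD mphi nuE mF F_fin _) fM.
by apply: filterS2 hk => z; exact: le_trans.
Qed.

(** The two summands are treated separately: the norm bound keeps each expectation in the L^p space
    of its summand. *)
Lemma ccondexp_exists f : f \in cL1Linfty tau ->
  exists2 h, h \in cL1Linfty nu & ccondexp f h.
Proof.
have Lp p g : p = 1%E \/ p = +oo%E -> cLfun tau p g ->
    exists2 h, cLfun nu p h & ccondexp g h.
  move=> p1y [mg ng].
  have iG n : [/\ tau.-integrable (D `&` phi @^-1` F n) (EFin \o (fun x => complex.Re (g x))) &
      tau.-integrable (D `&` phi @^-1` F n) (EFin \o (fun x => complex.Im (g x)))].
    have mfib := measurable_fiber mD mphi (mF n).
    have fin : (tau (D `&` phi @^-1` F n) < +oo)%E by rewrite -nuE.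
    exact: normc_integrable_ReIm mfib mg (cLfun_normc_integrable p1y (conj mg ng) mfib fin).
  have [hr hrP] := condexp_exists mD mphi nuE mF F_cover F_fin (fun n => (iG n).1).
  have [hi hiP] := condexp_exists mD mphi nuE mF F_cover F_fin (fun n => (iG n).2).
  have gh : ccondexp g (fun z => hr z +i* hi z)%C by [].
  exists (fun z => hr z +i* hi z)%C => //; split.
    by case: hrP => mr _ _ _; case: hiP => mi _ _ _.
  exact: le_lt_trans (ccondexp_cLnorm p1y mg gh) ng.
move=> /cL1LinftyP[f1 [f2 [L1 Ly ->]]].
have [h1 Lh1 fh1] := Lp _ _ (or_introl erefl) L1.
have [h2 Lh2 fh2] := Lp _ _ (or_intror erefl) Ly.
exists (h1 + h2); first by apply/cL1LinftyP; exists h1, h2.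
have := ccondexp_lin 1 fh1 fh2.
by congr ccondexp; apply/funext => x; rewrite mul1r.
Qed.

Lemma condexp_operator : exists A : {linear L1Linfty tau -> L1Linfty nu},
  forall f : L1Linfty tau, ccondexp f (A f : L1Linfty nu).
Proof.
apply: (@linear_of_rel _ _ _ (fun (f : L1Linfty tau) (h : L1Linfty nu) =>
  ccondexp f h)) => [f|a f1 f2 h1 h2 fh1 fh2|f h k fh fk].
- have [h hL fh] := ccondexp_exists (L1Linfty_in f).
  have [q qh] := L1Linfty_of_fun hL; exists q.
  apply: ccondexp_ae fh => //; try exact: cL1Linfty_cmeasurable (L1Linfty_in _).
    exact: nearW.
  by apply: filterS qh => z ->.
- apply: ccondexp_ae (ccondexp_lin a fh1 fh2).
  + exact: cL1Linfty_cmeasurable (L1Linfty_in _).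
  + exact: cL1Linfty_cmeasurable (L1Linfty_in _).
  + by apply: filterS (L1Linfty_lin_ae a f1 f2) => x ->.
  + by apply: filterS (L1Linfty_lin_ae a h1 h2) => x ->.
- by apply/L1Linfty_ae_eq; exact: ccondexp_uniq fk.
Qed.

End complex_conditional_expectation.

(** * Composition with a map, extended by zero *)

Section composition_operator.
Context dS dZ (S : measurableType dS) (Z : measurableType dZ) (R : realType).
Variables (tau : {measure set S -> \bar R}) (nu : {measure set Z -> \bar R}).
Variables (D : set S) (phi : S -> Z).

(** The value [0] off [D] preserves positivity and adds nothing to either norm. *)
Definition pullback (h : Z -> R[i]) : S -> R[i] := fun x => if x \in D then h (phi x) else 0.

Hypotheses (mD : measurable D) (mphi : measurable_fun setT phi).
Hypothesis nuE : forall E, measurable E -> nu E = tau (D `&` phi @^-1` E).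

Lemma cmeasurable_pullback h : cmeasurable h -> cmeasurable (pullback h).
Proof.
move=> [mr mi]; split.
- rewrite (_ : (fun _ => _) = (fun x => complex.Re (h (phi x))) \_ D).
    apply/(measurable_restrictT _ mD); apply: measurable_funTS.
    exact: measurableT_comp mr mphi.
  by apply/funext => x; rewrite /pullback !patchE; case: ifP.
- rewrite (_ : (fun _ => _) = (fun x => complex.Im (h (phi x))) \_ D).
    apply/(measurable_restrictT _ mD); apply: measurable_funTS.
    exact: measurableT_comp mi mphi.
  by apply/funext => x; rewrite /pullback !patchE; case: ifP.
Qed.

Lemma pullback_ae (P : R[i] -> Prop) h : P 0 -> {ae nu, forall z, P (h z)} ->
  {ae tau, forall x, P (pullback h x)}.
Proof.
move=> P0 /(ae_fiber mD mphi nuE); apply: filterS => x.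
by rewrite /pullback; case: ifPn => // /[!inE] Dx; exact.
Qed.

(** For [p = 1] the change of variables gives equality; for [p = +oo] the essential bound is pulled
    back, null sets having null fibers in [D]. *)
Lemma pullback_cLnorm p h : p = 1%E \/ p = +oo%E -> cmeasurable h ->
  (cLnorm tau p (pullback h) <= cLnorm nu p h)%E.
Proof.
move=> p1y mh; have mnh := cmeasurable_normc mh.
case: p1y => ->.
  rewrite !cLnorm1E (ge0_integral_fiber mD mphi nuE)//; last 2 first.
  - exact/measurable_EFinP.
  - by move=> z _; rewrite lee_fin normc_ge0.
  rewrite preimage_setT setIT [leRHS]integral_mkcond le_eqVlt; apply/orP; left.
  apply/eqP; apply: eq_integral => x _; rewrite /pullback patchE.
  by case: ifP => // _; rewrite Normc.normc0.
have nh0 : (0 <= cLnorm nu +oo%E h)%E by exact: Lnorm_ge0.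
have [->|hy] := eqVneq (cLnorm nu +oo%E h) +oo%E; first by rewrite leey.
have /fineK hE : cLnorm nu +oo%E h \is a fin_num by rewrite ge0_fin_numE// lt_neqAle hy leey.
rewrite -hE; apply/cLnormyP; rewrite ?fine_ge0//.
apply: (@pullback_ae (fun w => Normc.normc w <= _)).
  by rewrite Normc.normc0 fine_ge0.
by apply/cLnormyP; rewrite ?fine_ge0// hE.
Qed.

Lemma pullback_cL1Linfty h : h \in cL1Linfty nu -> pullback h \in cL1Linfty tau.
Proof.
have Lp p g : p = 1%E \/ p = +oo%E -> cLfun nu p g -> cLfun tau p (pullback g).
  move=> p1y [mg ng]; split; first exact: cmeasurable_pullback.
  exact: le_lt_trans (pullback_cLnorm p1y mg) ng.
move=> /cL1LinftyP[h1 [h2 [L1 Ly ->]]]; apply/cL1LinftyP.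
exists (pullback h1), (pullback h2); split.
- by apply: Lp => //; left.
- by apply: Lp => //; right.
- apply/funext => x; rewrite /pullback /GRing.add/=.
  by case: ifP => // _; rewrite addr0.
Qed.

Lemma composition_operator : exists A : {linear L1Linfty nu -> L1Linfty tau},
  forall h : L1Linfty nu, {ae tau, forall x, (A h : L1Linfty tau) x = pullback h x}.
Proof.
apply: (@linear_of_rel _ _ _ (fun (h : L1Linfty nu) (g : L1Linfty tau) =>
  {ae tau, forall x, g x = pullback h x})) => [h|a h1 h2 g1 g2 H1 H2|h g1 g2 H1 H2].
- have := pullback_cL1Linfty (L1Linfty_in h); exact: L1Linfty_of_fun.
- have ah := ae_fiber mD mphi nuE (L1Linfty_lin_ae a h1 h2).
  have H12 : {ae tau, forall x, 
      (g1 : L1Linfty tau) x = pullback (h1 : L1Linfty nu) x /\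
      (g2 : L1Linfty tau) x = pullback (h2 : L1Linfty nu) x}.
    by apply: filterS2 H1 H2.
  apply: filterS3 H12 (L1Linfty_lin_ae a g1 g2) ah.
  move=> x [gx1 gx2] ->; rewrite gx1 gx2 /pullback.
  by case: ifPn => [/set_mem Dx /(_ Dx) ->|_ _]; rewrite ?mulr0 ?addr0.
- by apply/L1Linfty_ae_eq; apply: filterS2 H1 H2 => x -> ->.
Qed.

End composition_operator.

(** * Contractions of both norms *)

Section contractions.
Context d1 d2 (T1 : measurableType d1) (T2 : measurableType d2) (R : realType).
Variables (alpha : {measure set T1 -> \bar R}) (beta : {measure set T2 -> \bar R}).

Lemma admissible_contraction (A : {linear L1Linfty alpha -> L1Linfty beta}) :
  (forall p f, p = 1%E \/ p = +oo%E -> (LpNorm p (A f) <= LpNorm p f)%E) ->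
  admissible A /\ (admissible_norm A <= 1)%E.
Proof.
move=> H; have H1 := H _ _ (or_introl erefl); have Hy := H _ _ (or_intror erefl).
split; first by split; exists 1 => f _; rewrite mul1e.
rewrite /admissible_norm ge_max; apply/andP; split.
- by apply: ge_ereal_sup => _ [f /= f1 <-]; exact: le_trans (H1 f) f1.
- by apply: ge_ereal_sup => _ [f /= f1 <-]; exact: le_trans (Hy f) f1.
Qed.

End contractions.

(** * Transfer between two spaces over a common image measure *)

Section transfer.
Context d1 d2 dZ (S : measurableType d1) (T : measurableType d2)
  (Z : measurableType dZ) (R : realType).
Variables (sigma : {measure set S -> \bar R}) (tau : {measure set T -> \bar R}).
Variables (nu : {measure set Z -> \bar R}) (F : (set Z)^nat).
Variables (D : set S) (phi : S -> Z) (D' : set T) (phi' : T -> Z).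
Hypotheses (mD : measurable D) (mphi : measurable_fun setT phi).
Hypotheses (mD' : measurable D') (mphi' : measurable_fun setT phi').
Hypothesis nuE : forall E, measurable E -> nu E = sigma (D `&` phi @^-1` E).
Hypothesis nuE' : forall E, measurable E -> nu E = tau (D' `&` phi' @^-1` E).
Hypotheses (mF : forall n, measurable (F n)) (F_cover : \bigcup_n F n = setT).
Hypothesis F_fin : forall n, (nu (F n) < +oo)%E.

(* Conditional expectation onto [Z] followed by composition with [phi']. *)
Lemma transfer_operator : exists A : {linear L1Linfty sigma -> L1Linfty tau},
  [/\ positive_map A, admissible A, (admissible_norm A <= 1)%E &
  forall (f : L1Linfty sigma) n E, measurable E -> E `<=` F n ->
    cintegral tau (D' `&` phi' @^-1` E) (A f : L1Linfty tau) =
    cintegral sigma (D `&` phi @^-1` E) f].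
Proof.
have [X XP] := condexp_operator mD mphi nuE mF F_cover F_fin.
have [C CP] := composition_operator mD' mphi' nuE'.
pose A : {linear L1Linfty sigma -> L1Linfty tau} := C \o X.
have mL d (U : measurableType d) (m : {measure set U -> \bar R}) (q : L1Linfty m) :
  cmeasurable q by exact: cL1Linfty_cmeasurable (L1Linfty_in q).
have [adm nrm] : admissible A /\ (admissible_norm A <= 1)%E.
  apply: admissible_contraction => p f p1y.
  rewrite (eq_LpNorm p1y (CP (X f))); last by apply: cmeasurable_pullback.
  apply: le_trans (pullback_cLnorm mD' mphi' nuE' p1y (mL _ _ _ (X f : L1Linfty nu))) _.
  exact: ccondexp_cLnorm (XP f).
exists A; split => // [f f0|f n E mE EF].
  have X0 : {ae nu, forall z, 0 <= (X f : L1Linfty nu) z} 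
    by exact: (ccondexp_ge0 _ _ _ _ _ _ (XP f)).
  have := @pullback_ae _ _ _ _ _ _ _ _ _ mD' mphi' nuE' (fun w => 0 <= w) _ (lexx 0) X0.
  by apply: filterS2 (CP (X f)) => x ->.
have [[mr _ _ rE] [mi _ _ iE]] := XP f.
have mfib := measurable_fiber mD' mphi' mE.
(* [part] is the real or the imaginary part. A change of variables moves the integral of [A f] to
   that of [X f] over [E], which the last hypothesis, supplied by the conditional expectation, ties
   to [f]. *)
have H (part : R[i] -> R) (g : S -> R) :
    measurable_fun setT (fun z => part ((X f : L1Linfty nu) z)) ->
    measurable_fun setT (fun x => part ((A f : L1Linfty tau) x)) ->
    (\int[nu]_(z in E) (part ((X f : L1Linfty nu) z))%:E =
     \int[sigma]_(x in D `&` phi @^-1` E) (g x)%:E)%E ->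
    (\int[tau]_(x in D' `&` phi' @^-1` E) (part ((A f : L1Linfty tau) x))%:E =
     \int[sigma]_(x in D `&` phi @^-1` E) (g x)%:E)%E.
  move=> mX mA <-; rewrite (integral_fiber mD' mphi' nuE')//; last first.
    by apply/measurable_EFinP; exact: measurable_funTS.
  apply: ae_eq_integral => //.
  - by apply/measurable_EFinP; exact: measurable_funTS.
  - apply/measurable_EFinP; apply: measurable_funTS.
    exact: (measurableT_comp mX mphi').
  - by apply: filterS (CP (X f)) => x -> [Dx _]; rewrite /pullback mem_set.
have [mAr mAi] := mL _ _ _ (A f).
rewrite /cintegral /Rintegral (H _ _ mr mAr (rE n E mE EF)).
by rewrite (H _ _ mi mAi (iE n E mE EF)).
Qed.

End transfer.

(** * Measures of chains and null changes of the domain *)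

Section chains.
Context d (S : measurableType d) (R : realType) (tau : {measure set S -> \bar R}).
Local Open Scope ereal_scope.

(** A finite union of members of a chain lies in a single member; continuity from below along the
    partial unions does the rest. *)
Lemma measure_chain_bigcup (C : (set S)^nat) : (forall n, measurable (C n)) ->
  (forall m n, C m `<=` C n \/ C n `<=` C m) ->
  tau (\bigcup_n C n) = ereal_sup [set tau (C n) | n in setT].
Proof.
move=> mC chain; apply/eqP; rewrite eq_le; apply/andP; split; last first.
  apply: ge_ereal_sup => _ [n _ <-]; apply: le_measure; rewrite ?inE//.
    exact: bigcupT_measurable.
  exact: bigcup_sup.
pose G n := \big[setU/set0]_(i < n.+1) C i.
have mG n : measurable (G n) by exact: bigsetU_measurable.
have GE : \bigcup_n C n = \bigcup_n G n by rewrite bigcup_bigsetU_bigcup.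
have ndG : nondecreasing_seq G.
  by move=> m n mn; apply/subsetPset; apply: subset_bigsetU.
have cvG := @nondecreasing_cvg_mu _ _ _ tau _ mG (bigcupT_measurable _ mG) ndG.
rewrite GE -(cvg_lim _ cvG)//; apply: lime_le; first exact: (cvgP _ cvG).
apply: nearW => n /=.
have [j Gj] : exists j, G n `<=` C j.
  elim: n => [|n [j IH]].
    by exists 0%N; rewrite /G big_ord_recl big_ord0 setU0.
  rewrite /G big_ord_recr/= -/(G n).
  have [CC|CC] := chain j n.+1.
    by exists n.+1; rewrite subUset; split => //; exact: subset_trans CC.
  by exists j; rewrite subUset; split.
apply: (@le_trans _ _ (tau (C j))); first by apply: le_measure; rewrite ?inE.
by apply: ereal_sup_ubound; exists j.
Qed.

(** Serves to trade a member of a chain for a sublevel set of the index. *)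
Lemma integral_null_symdiff A1 A2 (f : S -> \bar R) : measurable A1 -> measurable A2 ->
  measurable_fun setT f -> tau (A1 `\` A2) = 0 -> tau (A2 `\` A1) = 0 ->
  \int[tau]_(x in A1) f x = \int[tau]_(x in A2) f x.
Proof.
move=> m1 m2 mf n1 n2; rewrite integral_mkcond [RHS]integral_mkcond.
apply: ae_eq_integral => //.
- by apply/(measurable_restrictT _ m1); exact: measurable_funTS.
- by apply/(measurable_restrictT _ m2); exact: measurable_funTS.
exists ((A1 `\` A2) `|` (A2 `\` A1)); split.
- by apply: measurableU; exact: measurableD.
- by rewrite measureU0//; exact: measurableD.
move=> x /= /not_implyP[_]; rewrite !patchE.
have [x1|x1] := pselect (A1 x); have [x2|x2] := pselect (A2 x).
- by rewrite !mem_set.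
- by left.
- by right.
- by rewrite !memNset.
Qed.

End chains.

(** * The index function of a chain *)

Section core_index.
Context d (S : measurableType d) (R : realType) (tau : {measure set S -> \bar R}).
Variables (Y : Type) (v : Y -> R) (u : nat -> Y) (B : Y -> set S).

Definition core_domain : set S := \bigcup_n B (u n).

(* Off [core_domain] this is the infimum of the empty set, that is [0]. *)
Definition core_index (s : S) : R := inf [set v (u n) | n in [set n | B (u n) s]].

Hypotheses (mB : forall y, measurable (B y)).
Hypothesis chainB : forall y z, B y `<=` B z \/ B z `<=` B y.
Hypothesis tauB : forall y, tau (B y) = (v y)%:E.
Hypothesis v_dense : forall y (e : R), 0 < e -> exists n, `|v (u n) - v y| < e.

Let v_ge0 y : 0 <= v y.
Proof. by rewrite -lee_fin -tauB. Qed.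

Lemma measurable_core_domain : measurable core_domain.
Proof. exact: bigcupT_measurable. Qed.

(** An infimum is below [c] exactly when some member is: membership in the domain makes the set
    non-empty, and [0] bounds it from below. *)
Lemma core_sublevel c : core_domain `&` core_index @^-1` `]-oo, c[ =
  \bigcup_(n in [set n | v (u n) < c]) B (u n).
Proof.
apply/seteqP; split => s /=.
  move=> [[n _ Bns]]; rewrite in_itv/= => /inf_lt[|_ [m Bms <-] mc].
    by exists (v (u n)), n.
  by exists m.
move=> [n /= nc Bns]; split; first by exists n.
rewrite in_itv/=; apply: le_lt_trans nc; apply: ge_inf; last by exists n.
by exists 0 => _ [m _ <-].
Qed.

Let mlt c : measurable (\bigcup_(n in [set n | v (u n) < c]) B (u n)).
Proof. exact: bigcup_measurable. Qed.

Lemma measurable_core_index : measurable_fun setT core_index.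
Proof.
apply: (measurability _ (RGenInftyO.measurableE R)) => _ [_ [c ->] <-].
rewrite setTI.
(* Off the domain the index is [0], which lies below [c] exactly when [0 < c]; hence the second set
   of the union. *)
rewrite (_ : core_index @^-1` `]-oo, c[ =
  \bigcup_(n in [set n | v (u n) < c]) B (u n) `|`
  (~` core_domain `&` [set _ | 0 < c])).
  apply: measurableU => //; apply: measurableI.
    by apply: measurableC; exact: measurable_core_domain.
  have [c0|c0] := boolP (0 < c).
    by rewrite (_ : [set _ | _] = setT)//; apply/seteqP; split.
  by rewrite (_ : [set _ | _] = set0)//; apply/seteqP; split.
rewrite -core_sublevel.
have idx0 s : ~ core_domain s -> core_index s = 0.
  move=> Ds; rewrite /core_index (_ : [set _ | _ in _] = set0) ?inf0//.
  by apply/seteqP; split => // _ [n /= Bns _]; apply: Ds; exists n.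
apply/seteqP; split => s /=.
  have [Ds|Ds] := pselect (core_domain s); first by left.
  by rewrite in_itv/= idx0// => c0; right.
by move=> [[]//|[Ds c0]]; rewrite in_itv/= idx0.
Qed.

(** The right side involves only the numbers [v (u n)], so two chains with the same measures induce
    the same image measure on open half-lines. *)
Lemma measure_core_sublevel c : tau (core_domain `&` core_index @^-1` `]-oo, c[) =
  ereal_sup [set (if v (u n) < c then v (u n) else 0)%:E | n in setT].
Proof.
(* Empty sets replace the members with [c <= v (u n)], so that the chain remains indexed by all of
   [nat]. *)
pose C n := if v (u n) < c then B (u n) else set0.
have tauC n : tau (C n) = (if v (u n) < c then v (u n) else 0)%:E.
  by rewrite /C; case: ifP => _; rewrite ?tauB ?measure0.
rewrite core_sublevel (_ : \bigcup_(n in _) _ = \bigcup_n C n).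
  rewrite measure_chain_bigcup.
  - by congr ereal_sup; apply/seteqP; split => _ [n _ <-]; exists n.
  - by move=> n; rewrite /C; case: ifP.
  - move=> m n; rewrite /C; case: ifP => _; last by left.
    by case: ifP => _; [exact: chainB|right].
apply/seteqP; split => s /=.
  by move=> [n /= nc Bns]; exists n; rewrite // /C nc.
by move=> [n _]; rewrite /C; case: ifP => // nc Bns; exists n.
Qed.

Lemma measure_core_sublevel_le c : 0 <= c ->
  (tau (core_domain `&` core_index @^-1` `]-oo, c[) <= c%:E)%E.
Proof.
move=> c0; rewrite measure_core_sublevel; apply: ge_ereal_sup => _ [n _ <-].
by rewrite lee_fin; case: ifP => // /ltW.
Qed.

Let msub c : measurable (core_domain `&` core_index @^-1` `]-oo, c[).
Proof. by rewrite core_sublevel. Qed.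

Let msubc c : measurable (core_domain `&` core_index @^-1` `]-oo, c]).
Proof.
apply: measurableI; first exact: measurable_core_domain.
by rewrite -[X in measurable X]setTI; exact: measurable_core_index.
Qed.

(** By density some [B (u n)] has measure below [c] and within [e] of [v y]. It lies in the sublevel
    set and, being comparable with [B y], leaves less than [e] of it uncovered. *)
Let core_sub_sublevel y c : v y < c ->
  tau (B y `\` (core_domain `&` core_index @^-1` `]-oo, c[)) = 0%E.
Proof.
move=> yc; set L := _ `&` _; have mL : measurable L by exact: msub.
apply/eqP; rewrite eq_le measure_ge0 andbT.
apply/lee_addgt0Pr => e e0; rewrite add0e.
(* The bound [c - v y] keeps [v (u n)] below [c]; the bound [e] controls the uncovered measure. *)
have ec : 0 < Num.min e (c - v y) by rewrite lt_min e0 subr_gt0.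
have [n] := v_dense y ec; rewrite lt_min => /andP[ne nc].
have BL : B (u n) `<=` L.
  rewrite /L core_sublevel => s Bs; exists n => //=.
  by move: nc; rewrite ltr_norml; lra.
apply: (@le_trans _ _ (tau (B y `\` B (u n)))).
  by apply: le_measure; rewrite ?inE; [exact: measurableD|exact: measurableD|exact: setDS].
have [yn|ny] := chainB y (u n).
  by rewrite setDE (subsets_disjoint _ _).1// measure0 lee_fin ltW.
have -> : tau (B y `\` B (u n)) = (tau (B y) - tau (B y `&` B (u n)))%E.
  by apply: measureD => //; rewrite [ltLHS]tauB ltry.
rewrite setIidr// !tauB -EFinB lee_fin.
by move: ne; rewrite ltr_norml; lra.
Qed.

(** The closed sublevel set is the intersection of the open ones at [v y + k.+1%:R^-1], each
    containing almost all of [B y]. Conversely, the open one at [v y + e] has measure at most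
    [v y + e] and contains almost all of [B y], so its excess over [B y] is at most [e]. *)
Lemma core_level_null y :
  tau (B y `\` (core_domain `&` core_index @^-1` `]-oo, v y])) = 0%E /\
  tau ((core_domain `&` core_index @^-1` `]-oo, v y]) `\` B y) = 0%E.
Proof.
set L := _ `&` _; have mL : measurable L by exact: msubc.
split.
  apply/negligibleP; first exact: measurableD.
  rewrite (_ : B y `\` L = \bigcup_k (B y `\`
      (core_domain `&` core_index @^-1` `]-oo, v y + k.+1%:R^-1[))).
    apply: negligible_bigcup => k; apply/negligibleP; first exact: measurableD.
    by apply: core_sub_sublevel; rewrite ltrDl.
  apply/seteqP; split => s /=.
    move=> [Bs nL].
    have [Ds|Ds] := pselect (core_domain s); last by exists 0%N => //; split => // -[].
    have : v y < core_index s.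
      by rewrite ltNge; apply/negP => sy; apply: nL; split; rewrite //= in_itv.
    move=> /ltr_add_invr[k yk]; exists k => //; split => // -[_] /=.
    by rewrite in_itv/= ltNge (ltW yk).
  move=> [k _ [Bs nLk]]; split => // -[Ds]; rewrite /= in_itv/= => sy; apply: nLk.
  by split => //=; rewrite in_itv/= (le_lt_trans sy)// ltrDl.
apply/eqP; rewrite eq_le measure_ge0 andbT; apply/lee_addgt0Pr => e e0; rewrite add0e.
have ye : v y < v y + e by rewrite ltrDl.
set Lc := core_domain `&` core_index @^-1` `]-oo, v y + e[.
have mLc : measurable Lc by exact: msub.
have null : tau (B y `\` Lc) = 0%E by exact: core_sub_sublevel.
have Lce : (tau Lc <= (v y + e)%:E)%E.
  by apply: measure_core_sublevel_le; rewrite addr_ge0// ltW.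
apply: (@le_trans _ _ (tau (Lc `\` B y))).
  apply: le_measure; rewrite ?inE; [exact: measurableD|exact: measurableD|].
  apply: setSD => s [Ds]; rewrite /= in_itv/= => sy; split => //=.
  by rewrite in_itv/=; exact: le_lt_trans sy ye.
have LcI : tau (Lc `&` B y) = (v y)%:E.
  have DI : tau (B y) = (tau (B y `\` Lc) + tau (B y `&` Lc))%E by exact: measureDI.
  by rewrite setIC -tauB DI null add0e.
have -> : tau (Lc `\` B y) = (tau Lc - tau (Lc `&` B y))%E.
  by apply: measureD => //; exact: le_lt_trans Lce (ltry _).
rewrite LcI leeBlDr//; apply: le_trans Lce _.
by rewrite -EFinD lee_fin addrC.
Qed.

End core_index.

(** One index is chosen for each rational interval that contains a value of [v]; [y0] is the default
    for the others. *)
Lemma countable_dense_values (R : realType) (Y : Type) (y0 : Y) (v : Y -> R) :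
  exists u : nat -> Y, forall y (e : R), 0 < e -> exists n, `|v (u n) - v y| < e.
Proof.
have /choice[g gP] : forall pq : rat * rat, exists y0, forall y,
    ratr pq.1 < v y < ratr pq.2 -> ratr pq.1 < v y0 < ratr pq.2.
  move=> pq; have [[y ypq]|no] := pselect (exists y, ratr pq.1 < v y < ratr pq.2).
    by exists y.
  by exists y0 => y ypq; exfalso; apply: no; exists y.
exists (fun n => if unpickle n is Some pq then g pq else y0) => y e e0.
have [p] : exists p : rat, ratr p \in `]v y - e / 2, v y[.
  by have [|p pP] := @rat_in_itvoo R (v y - e / 2) (v y); [lra|exists p].
have [q] : exists q : rat, ratr q \in `]v y, v y + e / 2[.
  by have [|q qP] := @rat_in_itvoo R (v y) (v y + e / 2); [lra|exists q].
rewrite !in_itv/= => /andP[q1 q2] /andP[p1 p2].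
exists (pickle (p, q)); rewrite pickleK.
have := gP (p, q) y; rewrite /= p2 q1 => /(_ isT)/andP[? ?].
by rewrite ltr_norml; apply/andP; split; lra.
Qed.

(** * Transfer between two chains with the same measures *)

Section chain_transfer.
Context d1 d2 (S : measurableType d1) (T : measurableType d2) (R : realType).
Variables (sigma : {measure set S -> \bar R}) (tau : {measure set T -> \bar R}).
Variables (Y : Type) (v : Y -> R) (B : Y -> set S) (B' : Y -> set T).

Lemma chain_transfer_operator (y0 : Y) :
  (forall y, measurable (B y)) -> (forall y, measurable (B' y)) ->
  (forall y z, B y `<=` B z \/ B z `<=` B y) ->
  (forall y z, B' y `<=` B' z \/ B' z `<=` B' y) ->
  (forall y, sigma (B y) = (v y)%:E) -> (forall y, tau (B' y) = (v y)%:E) ->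
  exists A : {linear L1Linfty sigma -> L1Linfty tau},
    [/\ positive_map A, admissible A, (admissible_norm A <= 1)%E &
    forall (f : L1Linfty sigma) y,
      cintegral tau (B' y) (A f : L1Linfty tau) = cintegral sigma (B y) f].
Proof.
move=> mB mB' cB cB' sB tB'.
have [u u_dense] := countable_dense_values y0 v.
pose D := core_domain u B; pose phi : S -> measurableTypeR R := core_index v u B.
pose D' := core_domain u B'; pose phi' : T -> measurableTypeR R := core_index v u B'.
have mD : measurable D := measurable_core_domain u mB.
have mD' : measurable D' := measurable_core_domain u mB'.
have mphi : measurable_fun setT phi := measurable_core_index u mB sB.
have mphi' : measurable_fun setT phi' := measurable_core_index u mB' tB'.
pose nu0 : {measure set (measurableTypeR R) -> \bar R} :=
  @pushforward _ _ _ (measurableTypeR R) _ (mrestr sigma mD) phi.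
pose nu := nu0 mphi.
pose nu0' : {measure set (measurableTypeR R) -> \bar R} :=
  @pushforward _ _ _ (measurableTypeR R) _ (mrestr tau mD') phi'.
pose nu' := nu0' mphi'.
have nuE E : measurable E -> nu E = sigma (D `&` phi @^-1` E).
  by move=> _; rewrite setIC.
have nuE' E : measurable E -> nu' E = tau (D' `&` phi' @^-1` E).
  by move=> _; rewrite setIC.
pose F (n : nat) : set (measurableTypeR R) := `]-oo, n%:R[%classic.
have mF n : measurable (F n) by exact: measurable_itv.
have F_cover : \bigcup_n F n = setT.
  apply/seteqP; split => // x _; exists (Num.truncn `|x|).+1 => //=.
  by rewrite /F/= in_itv/= (le_lt_trans (ler_norm x))// truncnS_gt.
have F_fin n : (nu (F n) < +oo)%E.
  rewrite nuE//; apply: le_lt_trans (ltry n%:R).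
  by apply: measure_core_sublevel_le.
(* The open half-lines are stable under intersection and generate the Borel sets, and the sets [F n]
   of finite measure are among them, so agreement on half-lines suffices. *)
have nunu' (E : set (measurableTypeR R)) : measurable E -> nu E = nu' E.
  apply: (@measure_unique _ R (measurableTypeR R) (@RGenInftyO.G R) F
    (RGenInftyO.measurableE R)) => //.
  - move=> _ _ [a ->] [b ->]; exists (Num.min a b).
    by apply/seteqP; split => x /=; rewrite !in_itv/= lt_min => /andP.
  - by move=> n; exists n%:R.
  - by move=> _ [c ->]; rewrite nuE// nuE'// !measure_core_sublevel.
have nuE'' E : measurable E -> nu E = tau (D' `&` phi' @^-1` E).
  by move=> mE; rewrite nunu' ?nuE'.
have [A [posA admA normA AE]] :=
  transfer_operator mD mphi mD' mphi' nuE nuE'' mF F_cover F_fin.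
exists A; split => // f y.
have mL : measurable (`]-oo, v y]%classic : set (measurableTypeR R)) by exact: measurable_itv.
(* The transfer identity holds for sets inside one [F n], so the closed half-line is placed in a
   long enough one. *)
have LF : `]-oo, v y]%classic `<=` F (Num.truncn `|v y|).+1.
  move=> x; rewrite /F /= !in_itv/= => xy.
  by rewrite (le_lt_trans xy)// (le_lt_trans (ler_norm _))// truncnS_gt.
have cE d (U : measurableType d) (m : {measure set U -> \bar R}) A1 A2 (q : L1Linfty m) :
    measurable A1 -> measurable A2 -> m (A1 `\` A2) = 0%E -> m (A2 `\` A1) = 0%E ->
    cintegral m A1 q = cintegral m A2 q.
  move=> m1 m2 n1 n2; have [mr mi] := cL1Linfty_cmeasurable (L1Linfty_in q).
  rewrite /cintegral /Rintegral (integral_null_symdiff m1 m2 _ n1 n2); last exact/measurable_EFinP.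
  by rewrite (integral_null_symdiff m1 m2 _ n1 n2)//; exact/measurable_EFinP.
have [B1 B2] := core_level_null mB cB sB u_dense y.
have [B1' B2'] := core_level_null mB' cB' tB' u_dense y.
have mfib := measurable_fiber mD mphi mL; have mfib' := measurable_fiber mD' mphi' mL.
(* Both members are replaced by the sublevel sets at [v y], which differ from them by null sets and
   are fibers of one half-line. *)
rewrite (cE _ _ _ _ _ _ (mB' y) mfib' B1' B2') (cE _ _ _ _ _ _ (mB y) mfib B1 B2).
exact: AE LF.
Qed.

End chain_transfer.

(** * The two operators of a core map *)

Theorem theorem5p2 (R : realType) (dS dY : measure_display)
    (S : measurableType dS) (Y : measurableType dY)
    (lambda : {sigma_finite_measure set S -> \bar R})
    (mu : {sigma_finite_measure set Y -> \bar R})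
    (B : Y -> set S) (hB : core_map lambda B) :
  exists (RB : {linear L1Linfty (lebesgue_halfline R) -> L1Linfty lambda})
         (QB : {linear L1Linfty lambda -> L1Linfty (lebesgue_halfline R)}),
    [/\ positive_map RB, admissible RB & (admissible_norm RB <= 1)%E] /\
    [/\ positive_map QB, admissible QB & (admissible_norm QB <= 1)%E] /\
    (forall (f : L1Linfty (lebesgue_halfline R)) (y : Y),
       KB B (RB f) y = JB lambda B f y) /\
    (forall (g : L1Linfty lambda) (y : Y),
       JB lambda B (QB g) y = KB B g y).
Proof.
(* [Y] may be empty: [None] serves as an index in that case. *)
pose C (o : option Y) : set S := if o is Some y then B y else set0.
pose v o := fine (lambda (C o)).
pose C' o : set (measurableTypeR R) := `]0, v o[%classic.
have [mB cB _ _ finB] := hB.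
have mC o : measurable (C o) by case: o => [y|] /=.
have mC' o : measurable (C' o) by exact: measurable_itv.
have cC o p : C o `<=` C p \/ C p `<=` C o.
  by case: o p => [y|] [z|] /=; [exact: cB|right|left|left].
have v0 o : 0 <= v o by exact: fine_ge0.
have cC' o p : C' o `<=` C' p \/ C' p `<=` C' o.
  have sub x y : x <= y -> (`]0, x[%classic : set R) `<=` `]0, y[%classic.
    by move=> xy t /=; rewrite !in_itv/= => /andP[-> tx] /=; exact: lt_le_trans tx xy.
  by have [op|/ltW po] := leP (v o) (v p); [left|right]; exact: sub.
have lC o : lambda (C o) = (v o)%:E.
  rewrite /v fineK// ge0_fin_numE//; case: o => [y|]; first exact: finB.
  by rewrite /= measure0.
have lC' o : lebesgue_halfline R (C' o) = (v o)%:E.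
  rewrite /lebesgue_halfline /= /mrestr setIidl; last first.
    by move=> x; rewrite /C' /= !in_itv/= => /andP[->].
  (* In the second case [v o = 0] and the interval is empty. *)
  rewrite lebesgue_measure_itv/= lte_fin; case: ltP => [_|vo].
    by rewrite oppr0 addr0.
  by congr EFin; apply/eqP; rewrite eq_le v0.
(* The two chains play symmetric roles, so one transfer result applied in both directions yields
   both operators. *)
have [RB [pR aR nR RE]] := chain_transfer_operator None mC' mC cC' cC lC' lC.
have [QB [pQ aQ nQ QE]] := chain_transfer_operator None mC mC' cC cC' lC lC'.
exists RB, QB; do !split => //.
- by move=> f y; exact: RE f (Some y).
- by move=> g y; exact: QE g (Some y).
Qed.
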